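(* Let $\mathcal{H}$ be a complex Hilbert space, let $T\in\mathcal{B}(\mathcal{H})$ and let $S$ on $\mathcal{K}\supset\mathcal{H}$ and $S'$ on $\mathcal{K}'\supset\mathcal{H}$ be two minimal $2$-isometric liftings of $T$ with $S^*S\mathcal{H}\subset\mathcal{H}$ and $S'^*S'\mathcal{H}\subset\mathcal{H}$. Then $S$ and $S'$ are isomorphic if and only if $S^*S|_{\mathcal{H}}=S'^*S'|_{\mathcal{H}}$. If this is the case, then the $2$-isometries $S|_{\mathcal{K}\ominus\mathcal{H}}$ and $S'|_{\mathcal{K}'\ominus\mathcal{H}}$ are unitarily equivalent.
   Context: All Hilbert spaces are complex and operators are bounded and linear. $S$ is a $2$-isometry if $S^{*2}S^2-2S^*S+I=0$. If $\mathcal{H}$ is a closed subspace of $\mathcal{K}$, $S\in\mathcal{B}(\mathcal{K})$ is a lifting of $T\in\mathcal{B}(\mathcal{H})$ if $P_{\mathcal{H}}S=TP_{\mathcal{H}}$; it is minimal if $\mathcal{K}=\bigvee_{n\ge0}S^n\mathcal{H}$. Two liftings $S$ on $\mathcal{K}$ and $S'$ on $\mathcal{K}'$ of $T$ are isomorphic if there is a unitary $Z\in\mathcal{B}(\mathcal{K},\mathcal{K}')$ with $ZS=S'Z$ and $Zh=h$ for all $h\in\mathcal{H}$. *)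

(* Defs.v *)
From HB Require Import structures.
From mathcomp Require Import all_boot all_order all_algebra.
From mathcomp Require Import ring lra complex.
From mathcomp Require Import boolp classical_sets functions reals.
From mathcomp Require Import topology normedtype.

Set Implicit Arguments.
Unset Strict Implicit.
Unset Printing Implicit Defensive.

Import Order.TTheory GRing.Theory Num.Def Num.Theory.
Import numFieldNormedType.Exports.

Local Open Scope classical_set_scope.
Local Open Scope ring_scope.

(* Complex scalars are R[i] for R : realType. The inner product is linear in its
   first argument and conjugate-linear in the second; innerE ties it to the norm
   of the underlying Banach space. *)
HB.mixin Record CompleteNormedModule_isHilbert (R : realType) H
    & CompleteNormedModule R[i] H := {
  inner : {dot H for (@Num.conj R[i])};
  innerE : forall x : H, inner x x = `|x| ^+ 2
}.

#[short(type="hilbertType")]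
HB.structure Definition Hilbert (R : realType) :=
  {H of CompleteNormedModule_isHilbert R H & CompleteNormedModule R[i] H}.

Notation "''[' x , y ]" := (inner x y)
  (format "''[' x ,  y ]") : ring_scope.

Section InnerTheory.
Variables (R : realType) (H : hilbertType R).
Implicit Types x y z : H.

Lemma innerDl x y z : '[x + y, z] = '[x, z] + '[y, z].
Proof. exact: linearDl. Qed.

Lemma innerDr x y z : '[z, x + y] = '[z, x] + '[z, y].
Proof. exact: linearDr. Qed.

Lemma innerZl a x y : '[a *: x, y] = a * '[x, y].
Proof. exact: linearZl_LR. Qed.

Lemma innerZr a x y : '[x, a *: y] = a^* * '[x, y].
Proof. exact: linearZr_LR. Qed.

Lemma innerC x y : '[x, y] = '[y, x]^*.
Proof. by rewrite hermC/= expr0 mul1r. Qed.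

Lemma innerBl x y z : '[x - y, z] = '[x, z] - '[y, z].
Proof. by rewrite innerDl -scaleN1r innerZl mulN1r. Qed.

Lemma innerBr x y z : '[z, x - y] = '[z, x] - '[z, y].
Proof. by rewrite innerDr -scaleN1r innerZr rmorphN rmorph1 mulN1r. Qed.

Lemma inner0l y : '[0, y] = 0.
Proof. by rewrite -(scale0r (0 : H)) innerZl mul0r. Qed.

Lemma inner0r y : '[y, 0] = 0.
Proof. by rewrite -(scale0r (0 : H)) innerZr rmorph0 mul0r. Qed.

Lemma inner_eq0 x : ('[x, x] == 0) = (x == 0).
Proof. by rewrite innerE sqrf_eq0 normr_eq0. Qed.

Lemma inner_proj x y : y != 0 ->
  '[x - ('[x, y] / '[y, y]) *: y, x - ('[x, y] / '[y, y]) *: y]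
  = '[x, x] - `|'[x, y]| ^+ 2 / '[y, y].
Proof.
move=> y0; have yy0 : '[y, y] != 0 by rewrite inner_eq0.
set t := _ / _.
have ty : '[x - t *: y, y] = 0 by rewrite innerBl innerZl divfK// subrr.
rewrite innerBr innerZr ty mulr0 subr0 innerBl innerZl (innerC y x).
by rewrite normCK mulrAC.
Qed.

Lemma cauchy_schwarz x y : `|'[x, y]| <= `|x| * `|y|.
Proof.
have [->|y0] := eqVneq y 0; first by rewrite inner0r !normr0 mulr0.
rewrite -(@ler_sqr R[i]) ?nnegrE ?mulr_ge0// exprMn -!innerE.
have yy0 : 0 < '[y, y] by rewrite innerE exprn_gt0// normr_gt0.
by rewrite -ler_pdivrMr// -subr_ge0 -inner_proj// innerE exprn_ge0.
Qed.

Lemma parallelogram x y :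
  `|x - y| ^+ 2 + `|x + y| ^+ 2 = `|x| ^+ 2 *+ 2 + `|y| ^+ 2 *+ 2.
Proof.
rewrite -!innerE !innerBl !innerBr !innerDl !innerDr; ring.
Qed.

End InnerTheory.

Section Riesz.
Variables (R : realType) (H : hilbertType R).
Implicit Types x y z u v : H.

Let n x : R := complex.Re `|x|.

Let nE x : `|x| = (n x)%:C%C.
Proof. by rewrite RRe_real// normr_real. Qed.

Let n_ge0 x : 0 <= n x.
Proof. by rewrite -ler0c -nE. Qed.


Let n_parallelogram x y :
  n (x - y) ^+ 2 + n (x + y) ^+ 2 = n x ^+ 2 *+ 2 + n y ^+ 2 *+ 2.
Proof.
apply: (@complexI R); rewrite !(rmorphD, rmorphMn, rmorphXn)/= -!nE.
exact: parallelogram.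
Qed.

Lemma riesz (f : {scalar H}) (M : R[i]) : (forall x, `|f x| <= M * `|x|) ->
  exists z, forall x, f x = '[x, z].
Proof.
move=> fM; have [f0|/existsNP[x0 fx0]] := pselect (forall x, f x = 0).
  by exists 0 => x; rewrite f0 inner0r.
pose w := (f x0)^-1 *: x0.
have fw : f w = 1 by rewrite linearZ/= mulVf//; apply/eqP.
pose D : set R := [set n x | x in [set x | f x = 1]].
pose d := inf D.
have D0 : D !=set0 by exists (n w); exists w.
have Dlb : has_lbound D by exists 0 => _ [x _ <-].
have d0 : 0 <= d by apply: lb_le_inf => // _ [x _ <-].
have dle x : f x = 1 -> d <= n x by move=> fx; apply: ge_inf => //; exists x.
pose B (e : R) := [set x | f x = 1 /\ n x ^+ 2 < d ^+ 2 + e].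
have B0 e : 0 < e -> B e !=set0.
  move=> e0; pose t := minr 1 (e / (d *+ 2 + 1)).
  have t0 : 0 < t by rewrite lt_min ltr01 divr_gt0//; lra.
  have [_ [x fx <-] nx] := inf_adherent t0 (conj D0 Dlb).
  exists x; split => //; rewrite -/d in nx.
  have : t <= 1 by rewrite ge_min lexx.
  have : t * (d *+ 2 + 1) <= e.
    by rewrite -ler_pdivlMr ?ge_min ?lexx ?orbT//; lra.
  move: (n_ge0 x) (dle x fx) nx; nra.
have Bdist e x y : B e x -> B e y -> n (x - y) ^+ 2 < e *+ 4.
  move=> [fx nx] [fy ny].
  have : d *+ 2 <= n (x + y).
    have /dle : f (2^-1 *: (x + y)) = 1.
      by rewrite linearZ/= linearD fx fy -mulr2n -[1 *+ 2]/(2%:R) mulVf// pnatr_eq0.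
    have -> : n (2^-1 *: (x + y)) = 2^-1 * n (x + y).
      apply: (@complexI R); rewrite rmorphM/= -!nE normrZ fmorphV rmorph_nat.
      by rewrite ger0_norm// invr_ge0.
    lra.
  have := n_parallelogram x y; move: nx ny (n_ge0 (x + y)); nra.
pose F : set_system H := filter_from [set e : R | 0 < e] B.
have FF : ProperFilter F.
  apply: filter_from_proper; last by move=> e; exact: B0.
  apply: filter_from_filter; first by exists 1 => /=.
  move=> a b /= a0 b0; exists (minr a b); first by rewrite /= lt_min a0.
  move=> x [fx nx]; split; split => //.
    by apply: (lt_le_trans nx); rewrite lerD2l ge_min lexx.
  by apply: (lt_le_trans nx); rewrite lerD2l ge_min lexx orbT.
have Fc : cauchy F.
  apply: cauchy_exP => e e0.
  have eE : e = (complex.Re e)%:C%C by rewrite RRe_real// gtr0_real.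
  have e0' : 0 < complex.Re e by rewrite -ltcR -eE.
  have d4 : 0 < complex.Re e ^+ 2 / 4 by rewrite divr_gt0// exprn_gt0.
  have [x Bx] := B0 _ d4.
  exists x; exists (complex.Re e ^+ 2 / 4) => // y By.
  rewrite -ball_normE /ball_/= nE eE ltcR.
  rewrite -(@ltr_sqr R) ?nnegrE ?(ltW e0')//.
  by apply: (lt_le_trans (Bdist _ _ _ Bx By)); lra.
have /cvg_ex[u Fu] : cvg F by exact: cauchy_cvg.
have near_u (e : R) : 0 < e -> exists x, B e x /\ n (u - x) < e.
  move=> e0; have : F (ball u e%:C%C) by apply: Fu; apply: nbhsx_ballx; rewrite ltcR.
  case=> a /= a0 Ba; have m0 : 0 < minr a e by rewrite lt_min a0.
  have [x [fx nx]] := B0 _ m0.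
  exists x; split; first split => //.
    by apply: (lt_le_trans nx); rewrite lerD2l ge_min lexx orbT.
  have /Ba : B a x.
    by split => //; apply: (lt_le_trans nx); rewrite lerD2l ge_min lexx.
  by rewrite -ball_normE /ball_/= nE ltcR.
have M0 : 0 <= M.
  have wpos : 0 < `|w|.
    rewrite normr_gt0; apply/eqP => w0; move: fw; rewrite w0 linear0 => /eqP.
    by rewrite eq_sym oner_eq0.
  by rewrite -(pmulr_lge0 _ wpos); apply: le_trans (fM w).
have ME : M = (complex.Re M)%:C%C by rewrite RRe_real// ger0_real.
have M0' : 0 <= complex.Re M by rewrite -lecR -ME.
have fu : f u = 1.
  apply/eqP; rewrite -subr_eq0 -normr_eq0.
  have rE : `|f u - 1| = (complex.Re `|f u - 1|)%:C%C by rewrite RRe_real// normr_real.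
  rewrite rE; apply/eqP; congr (_%:C)%C.
  have r0 : 0 <= complex.Re `|f u - 1| by rewrite -ler0c -rE.
  apply/eqP; rewrite eq_le r0 andbT; apply/ler_addgt0Pr => e e0; rewrite add0r.
  have e1 : 0 < e / (complex.Re M + 1) by rewrite divr_gt0//; lra.
  have [x [[fx _] nx]] := near_u _ e1.
  rewrite -lecR -rE -fx -linearB; apply: (le_trans (fM _)).
  rewrite ME nE -rmorphM lecR.
  move: nx; rewrite ltr_pdivlMr; last lra.
  by move: (n_ge0 (u - x)); nra.
have nu x : f x = 1 -> `|u| <= `|x|.
  move=> /dle dx; rewrite !nE lecR; apply: (le_trans _ dx).
  apply/ler_addgt0Pr => e e0.
  pose t := minr (e / 2) (e ^+ 2 / 4).
  have t0 : 0 < t by rewrite lt_min !divr_gt0// exprn_gt0.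
  have [y [[fy ny] nuy]] := near_u _ t0.
  have t1 : t <= e / 2 by rewrite ge_min lexx.
  have t2 : t <= e ^+ 2 / 4 by rewrite ge_min lexx orbT.
  have nye : n y <= d + e / 2.
    rewrite -(@ler_sqr R) ?nnegrE//; last lra.
    by nra.
  have : n u <= n (u - y) + n y.
    by rewrite -lecR rmorphD/= -!nE -[in leLHS](subrK y u) ler_normD.
  lra.
have ortho v : f v = 0 -> '[v, u] = 0.
  move=> fv; have [->|v0] := eqVneq v 0; first by rewrite inner0l.
  have : '[u, u] <= '[u, u] - `|'[u, v]| ^+ 2 / '[v, v].
    rewrite -inner_proj// !innerE lerXn2r ?nnegrE//.
    by apply: nu; rewrite linearB linearZ/= fv mulr0 subr0.
  rewrite lerBrDr gerDl => h.
  have vv0 : 0 < '[v, v] by rewrite innerE exprn_gt0// normr_gt0.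
  rewrite pmulr_lle0 ?invr_gt0// in h.
  have /eqP : `|'[u, v]| ^+ 2 = 0 by apply/le_anti; rewrite h/= exprn_ge0.
  by rewrite sqrf_eq0 normr_eq0 => /eqP uv; rewrite innerC uv rmorph0.
have uu0 : '[u, u] != 0.
  rewrite inner_eq0; apply/eqP => u0; move: fu; rewrite u0 linear0 => /eqP.
  by rewrite eq_sym oner_eq0.
exists ('[u, u]^-1 *: u) => x.
have : '[x - f x *: u, u] = 0.
  by apply: ortho; rewrite linearB linearZ/= fu mulr1 subrr.
rewrite innerBl innerZl => /eqP; rewrite subr_eq0 => /eqP xu.
have uuC : '[u, u]^* = '[u, u] by rewrite -innerC.
by rewrite innerZr fmorphV/= uuC xu mulrC mulfK.
Qed.

End Riesz.

(* xget picks the Riesz representative of x |-> '[A x, y]; it exists when A is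
   linear and continuous, see adjointP. *)
Definition adjoint (R : realType) (H K : hilbertType R) (A : H -> K) : K -> H :=
  fun y => xget 0 [set z | forall x, '[A x, y] = '[x, z]].

Lemma adjointP (R : realType) (H K : hilbertType R) (A : {linear H -> K}) :
  continuous A -> forall x y, '[A x, y] = '[x, adjoint A y].
Proof.
move=> cA x y; rewrite /adjoint; case: xgetP => [z _ /(_ x)//|/= no].
have [M [_ AM]] := (linear_boundedP A).1 ((linear_bounded_continuous A).2 cA).
pose f (v : H) := '[A v, y].
have f_lin : scalar f.
  by move=> a u v; rewrite /f linearP innerDl innerZl.
pose fl : {scalar H} := HB.pack f (GRing.isLinear.Build R[i] H R[i] *%R f f_lin).
have fM v : `|fl v| <= (M + 1) * `|y| * `|v|.
  apply: (le_trans (cauchy_schwarz _ _)); rewrite mulrAC ler_wpM2r//.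
  by apply: AM; rewrite ltrDl.
by have [z zP] := riesz fM; case: (no z) => v; apply: zP.
Qed.

Definition isometric (R : realType) (H K : hilbertType R) (J : H -> K) : Prop :=
  forall x y, '[J x, J y] = '[x, y].

Definition unitary (R : realType) (H K : hilbertType R) (Z : H -> K) : Prop :=
  isometric Z /\ (forall y, exists x, Z x = y).

Lemma isometric_continuous (R : realType) (H K : hilbertType R)
  (J : {linear H -> K}) : isometric J -> continuous J.
Proof.
move=> iJ; apply: bounded_linear_continuous; apply/linear_boundedP.
exists 1; split=> [|r r1 x]; first exact: real1.
have <- : `|x| = `|J x|.
  apply/eqP; rewrite -(@eqrXn2 _ 2)//; first by rewrite -!innerE iJ.
by rewrite ler_peMl// ltW.
Qed.

Section Orthocomp.
Variables (R : realType) (H : hilbertType R) (A : set H).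

Definition orthocomp : set H := [set x | forall y, A y -> '[x, y] = 0].

(* The closed subspace orthocomp as a Hilbert space in its own right. *)
Record orthocomp_type :=
  OrthocompSub { orthocomp_val :> H; _ : orthocomp_val \in orthocomp }.

HB.instance Definition _ := [isSub for orthocomp_val].
HB.instance Definition _ := [Choice of orthocomp_type by <:].

Fact orthocomp_submod : subsemimod_closed (mem orthocomp).
Proof.
split.
  split=> [|x y]; rewrite ?inE; first by move=> z _; rewrite inner0l.
  by move=> xA yA z Az; rewrite innerDl xA// yA// addr0.
by move=> a x; rewrite !inE => xA z Az; rewrite innerZl xA// mulr0.
Qed.
HB.instance Definition _ := GRing.SubChoice_isSubLmodule.Build R[i] H
  (mem orthocomp) orthocomp_type orthocomp_submod.

Let nrm (x : orthocomp_type) : R[i] := `|val x|.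

Let nrmD x y : nrm (x + y) <= nrm x + nrm y.
Proof. by rewrite /nrm raddfD ler_normD. Qed.

Let nrmZ (l : R[i]) x : nrm (l *: x) = `|l| * nrm x.
Proof. by rewrite /nrm linearZ normrZ. Qed.

Let nrm_eq0 x : nrm x = 0 -> x = 0.
Proof. by move/normr0_eq0 => x0; apply: val_inj; rewrite x0 raddf0. Qed.

HB.instance Definition _ :=
  Lmodule_isNormed.Build R[i] orthocomp_type nrmD nrmZ nrm_eq0.

Lemma orthocomp_normE (x : orthocomp_type) : `|x| = `|val x|.
Proof. by []. Qed.

Lemma orthocomp_closed (F : set_system H) (l : H) :
  ProperFilter F -> F --> l -> F orthocomp -> orthocomp l.
Proof.
move=> FF Fl FA y Ay.
apply/eqP; rewrite -normr_eq0 eq_le normr_ge0 andbT.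
have rE : `|'[l, y]| = (complex.Re `|'[l, y]|)%:C%C.
  by rewrite RRe_real// normr_real.
have nE : `|y| = (complex.Re `|y|)%:C%C by rewrite RRe_real// normr_real.
have n0 : 0 <= complex.Re `|y| by rewrite -ler0c -nE.
rewrite rE -[0]/(0%:C%C) lecR; apply/ler_addgt0Pr => e e0; rewrite add0r.
rewrite -lecR -rE.
have e1 : 0 < e / (complex.Re `|y| + 1) by rewrite divr_gt0//; lra.
have Fb : F (ball l (e / (complex.Re `|y| + 1))%:C%C).
  by apply: Fl; apply: nbhsx_ballx; rewrite ltcR.
have [x [xA]] := filter_ex (filterI FA Fb).
rewrite -ball_normE /ball_/= => lx.
have -> : '[l, y] = '[l - x, y] by rewrite innerBl xA// subr0.
apply: (le_trans (cauchy_schwarz _ _)).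
apply: (@le_trans _ _ ((e / (complex.Re `|y| + 1))%:C%C * `|y|)).
  by rewrite ler_wpM2r// ltW.
rewrite nE -rmorphM lecR mulrAC ler_pdivrMr; nra.
Qed.

Let complete (F : set_system orthocomp_type) :
  ProperFilter F -> cauchy F -> cvg F.
Proof.
move=> FF /cauchyP Fc.
pose G : set_system H := (val : orthocomp_type -> H) @ F.
have GF : ProperFilter G by exact: fmap_proper_filter.
have Gc : cauchy G.
  apply: cauchy_exP => e e0; have [x Fx] := Fc e e0.
  exists (val x); rewrite /G /=; apply: filterS Fx => y.
  by rewrite -!ball_normE /ball_/= orthocomp_normE raddfB.
have /cvg_ex[l Gl] : cvg G by exact: cauchy_cvg.
have lA : l \in orthocomp.
  rewrite inE; apply: (orthocomp_closed GF Gl).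
  rewrite /G /=; apply: (@filterS _ F _ setT) filterT => x _ /=.
  by have := valP x; rewrite inE.
apply/cvg_ex; exists (OrthocompSub lA); apply/cvgrPdist_lt => e e0.
have : G (ball l e) by apply: Gl; exact: nbhsx_ballx.
rewrite -ball_normE /ball_/= /G /=; apply: filterS => y /=.
by rewrite orthocomp_normE raddfB.
Qed.

HB.instance Definition _ := Uniform_isComplete.Build orthocomp_type complete.

Definition orthocomp_inner (x y : orthocomp_type) : R[i] :=
  '[val x, val y].

Let inner_linearl y : GRing.linear_for *%R (orthocomp_inner^~ y).
Proof. by move=> a u v; rewrite /orthocomp_inner linearP innerDl innerZl. Qed.

Let inner_linearr x :
  GRing.linear_for (Num.conj \; *%R) (orthocomp_inner x).
Proof. by move=> a u v; rewrite /orthocomp_inner [val (_ + _)]linearP innerDr innerZr. Qed.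

HB.instance Definition _ := bilinear_isBilinear.Build R[i] orthocomp_type
  orthocomp_type R[i] *%R (Num.conj \; *%R) orthocomp_inner
  (inner_linearl, inner_linearr).

Let inner_herm x y :
  orthocomp_inner x y = (-1) ^+ false * (orthocomp_inner y x)^*.
Proof. by rewrite expr0 mul1r -innerC. Qed.

HB.instance Definition _ := isHermitianSesquilinear.Build R[i] orthocomp_type
  false Num.conj orthocomp_inner inner_herm.

Let inner_pos x : x != 0 -> 0 < orthocomp_inner x x.
Proof.
move=> x0; rewrite /orthocomp_inner innerE exprn_gt0// normr_gt0.
by apply: contra x0 => /eqP x0; apply/eqP/val_inj; rewrite x0 raddf0.
Qed.

HB.instance Definition _ := isDotProduct.Build R[i] orthocomp_type
  orthocomp_inner inner_pos.

HB.instance Definition _ := CompleteNormedModule_isHilbert.Build R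
  orthocomp_type (fun x => innerE (val x) : orthocomp_inner x x = `|x| ^+ 2).

End Orthocomp.

Section Restriction.
Variables (R : realType) (K : hilbertType R) (A : set K).
Variables (S : {linear K -> K}).
Hypothesis SA : forall x, orthocomp A x -> orthocomp A (S x).

Fact restriction_subproof (x : orthocomp_type A) : S (val x) \in orthocomp A.
Proof. by have := valP x; rewrite !inE; exact: SA. Qed.

Definition restriction (x : orthocomp_type A) : orthocomp_type A :=
  OrthocompSub (restriction_subproof x).

Fact restriction_linear : linear restriction.
Proof. by move=> a x y; apply: val_inj; rewrite /= linearP. Qed.

HB.instance Definition _ := GRing.isLinear.Build R[i] (orthocomp_type A)
  (orthocomp_type A) *:%R restriction restriction_linear.

End Restriction.

Definition two_isometry (R : realType) (K : hilbertType R)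
    (S : {linear K -> K}) : Prop :=
  continuous S /\
  forall x, adjoint S (adjoint S (S (S x))) - 2 *: adjoint S (S x) + x = 0.

Definition unitarily_equivalent (R : realType) (K K' : hilbertType R)
    (S : K -> K) (S' : K' -> K') : Prop :=
  exists Z : {linear K -> K'}, unitary Z /\ forall x, Z (S x) = S' (Z x).

Definition linear_span (R : realType) (K : hilbertType R) (A : set K) : set K :=
  [set x | exists (m : nat) (c : 'I_m -> R[i]) (v : 'I_m -> K),
    (forall i, A (v i)) /\ x = \sum_(i < m) c i *: v i].

(* An inclusion of a Hilbert space H as a closed subspace of K is encoded by an
   isometric linear map J : H -> K; its range is closed because H is complete. *)

(* The orthogonal projection of K onto H, with values in H; see orthoprojP. *)
Definition orthoproj (R : realType) (H K : hilbertType R) (J : H -> K) (x : K) :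
    H :=
  xget 0 [set h | orthocomp (range J) (x - J h)].

Lemma orthoprojP (R : realType) (H K : hilbertType R) (J : {linear H -> K}) x :
  isometric J -> orthocomp (range J) (x - J (orthoproj J x)).
Proof.
move=> iJ; rewrite /orthoproj; case: xgetP => [//|/= /(_ (adjoint J x))[]].
move=> _ [h _ <-]; rewrite innerBl iJ (innerC x).
by rewrite (adjointP (isometric_continuous iJ)) -innerC subrr.
Qed.

Lemma orthoproj_eq0 (R : realType) (H K : hilbertType R) (J : {linear H -> K}) x :
  isometric J -> orthocomp (range J) x <-> orthoproj J x = 0.
Proof.
move=> iJ; have xP := orthoprojP x iJ; split=> [xJ|p0]; last first.
  by rewrite p0 linear0 subr0 in xP.
have Jp : range J (J (orthoproj J x)) by exists (orthoproj J x).
have := xP _ Jp; rewrite innerBl (xJ _ Jp) iJ sub0r => /eqP.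
by rewrite oppr_eq0 inner_eq0 => /eqP.
Qed.

Definition lifting (R : realType) (H K : hilbertType R) (J : H -> K)
    (T : H -> H) (S : K -> K) : Prop :=
  forall x, orthoproj J (S x) = T (orthoproj J x).

Lemma lifting_orthocomp (R : realType) (H K : hilbertType R)
    (J : {linear H -> K}) (T : {linear H -> H}) (S : K -> K) :
  isometric J -> lifting J T S ->
  forall x, orthocomp (range J) x -> orthocomp (range J) (S x).
Proof.
move=> iJ JTS x /(orthoproj_eq0 _ iJ) x0; apply/(orthoproj_eq0 _ iJ).
by rewrite JTS x0 linear0.
Qed.

Definition minimal_lifting (R : realType) (H K : hilbertType R) (J : H -> K)
    (S : K -> K) : Prop :=
  closure (linear_span (\bigcup_n (iter n S @` range J))) = setT.

Definition isomorphic_liftings (R : realType) (H K K' : hilbertType R)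
    (J : H -> K) (S : K -> K) (J' : H -> K') (S' : K' -> K') : Prop :=
  exists Z : {linear K -> K'}, [/\ unitary Z,
    forall x, Z (S x) = S' (Z x) & forall h, Z (J h) = J' h].

(* A : K -> K and A' : K' -> K' map H into itself and A|_H = A'|_H, where H is
   identified with its images under J and J'. *)
Definition same_restriction (R : realType) (H K K' : hilbertType R)
    (J : H -> K) (A : K -> K) (J' : H -> K') (A' : K' -> K') : Prop :=
  forall h, exists g, A (J h) = J g /\ A' (J' h) = J' g.

(* Main.v *)
Require Import Defs.
From HB Require Import structures.
From mathcomp Require Import all_boot all_order all_algebra.
From mathcomp Require Import complex.
From mathcomp Require Import boolp classical_sets functions reals.
From mathcomp Require Import topology normedtype.
Import Order.TTheory GRing.Theory Num.Theory.
Import numFieldNormedType.Exports.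
Local Open Scope classical_set_scope.
Local Open Scope ring_scope.

(** A minimal lifting is determined, up to isomorphism, by the Gram matrix of
    the vectors S^n (J h), because these vectors span a dense subspace of K:
    two families with the same Gram matrix and dense spans are exchanged by
    a unitary ([gram_unitary]), which here intertwines S with S'
    because it sends S^n (J h) to S'^n (J' h) ([gram_isomorphic]).

    For a 2-isometry the sequence of forms <S^n x, S^n y> satisfies a linear
    recurrence of order two, so the whole Gram matrix follows from the entries
    <S^n (J h), J g> and <S^(n+1) (J h), S (J g)>
    ([two_isometry_orbit_gram]). The first is <T^n h, g> by the lifting
    property. The second is <S^n (J h), S^*S (J g)>; since S^*S maps H into
    itself, S^*S (J g) = J k for some k, and the entry equals <T^n h, k>. Hence
    T and the restriction of S^*S to H determine everything, which is the
    nontrivial implication ([same_restriction_gram]).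

    Conversely a unitary intertwining S and S' intertwines S^*S and S'^*S', so
    the two restrictions to H agree. It also carries the orthogonal complement
    of J(H) onto that of J'(H), hence gives the unitary equivalence of the
    parts of S and S' there. These parts are 2-isometries because the 2-isometry
    identity, written with inner products ([two_isometryP]), passes to any
    invariant subspace. *)

Set Implicit Arguments.
Unset Strict Implicit.

(** * Inner products and bounded maps *)

Section InnerProduct.
Context {R : realType} {H K : hilbertType R}.

Lemma inner_suml m (c : 'I_m -> R[i]) (v : 'I_m -> H) (y : H) :
  '[\sum_(i < m) c i *: v i, y] = \sum_(i < m) c i * '[v i, y].
Proof.
rewrite (big_morph (fun x => '[x, y]) (fun a b => innerDl a b y) (inner0l y)).
by apply: eq_bigr => i _; rewrite innerZl.
Qed.

Lemma inner_sumr m (c : 'I_m -> R[i]) (v : 'I_m -> H) (y : H) :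
  '[y, \sum_(i < m) c i *: v i] = \sum_(i < m) (c i)^* * '[y, v i].
Proof.
rewrite (big_morph (fun x => '[y, x]) (fun a b => innerDr a b y) (inner0r y)).
by apply: eq_bigr => i _; rewrite innerZr.
Qed.

Lemma inner_extl (x y : H) : (forall z, '[z, x] = '[z, y]) -> x = y.
Proof.
move=> xy; apply/eqP; rewrite -subr_eq0 -inner_eq0 innerBr xy.
by rewrite -innerBr subrr inner0r.
Qed.

Lemma eq_inner_norm (x : H) (y : K) : '[x, x] = '[y, y] -> `|x| = `|y|.
Proof.
by rewrite !innerE => /eqP xy; apply/eqP; rewrite -(@eqrXn2 _ 2).
Qed.

Lemma cvg_innerl (U : Type) (F : set_system U) {FF : Filter F} (f : U -> H)
    (l y : H) :
  f @ F --> l -> (fun t => '[f t, y]) @ F --> '[l, y].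
Proof.
move=> fl; apply/cvgrPdist_lt => e e0.
have y1 : 0 < `|y| + 1 by rewrite ltr_wpDl.
have : \forall t \near F, `|l - f t| < e / (`|y| + 1).
  by move/cvgrPdist_lt : fl; apply; rewrite divr_gt0.
apply: filterS => t; rewrite ltr_pdivlMr// => lt_e.
rewrite -innerBl; apply: le_lt_trans lt_e.
by apply: (le_trans (cauchy_schwarz _ _)); rewrite ler_wpM2l// lerDl.
Qed.

Lemma bounded_continuous (A : {linear H -> K}) (M : R[i]) :
  0 <= M -> (forall x, `|A x| <= M * `|x|) -> continuous A.
Proof.
move=> M0 AM; apply: bounded_linear_continuous; apply/linear_boundedP.
exists M; split=> [|r Mr x]; first exact: ger0_real.
by apply: (le_trans (AM x)); rewrite ler_wpM2r// ltW.
Qed.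

End InnerProduct.

(** * Families with dense span and their Gram matrices *)

Section TotalFamily.
Context {R : realType} {I : Type}.

Definition total {K : hilbertType R} (v : I -> K) : Prop :=
  closure (linear_span (range v)) = setT.

(** A vector orthogonal to the span is orthogonal to its closure, hence to
    itself. *)
Lemma total_orth0 {K : hilbertType R} (v : I -> K) (y : K) : total v ->
  (forall i, '[v i, y] = 0) -> y = 0.
Proof.
move=> tv vy0; apply/eqP; rewrite -inner_eq0; apply/eqP.
have yD : closure (linear_span (range v)) y by rewrite tv.
have FF := within_nbhs_proper yD.
have Fy : within (linear_span (range v)) (nbhs y) --> y by exact: cvg_within.
apply: (orthocomp_closed (A := [set y]) FF Fy) => //.
apply: (filterS _ (withinT _ _)) => a [m [c [w [wv ->]]]] _ ->.
rewrite inner_suml big1// => j _; have [i _ <-] := wv j.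
by rewrite vy0 mulr0.
Qed.

Lemma total_inner_ext {K : hilbertType R} (v : I -> K) (x y : K) : total v ->
  (forall i, '[v i, x] = '[v i, y]) -> x = y.
Proof.
move=> tv xy; apply/eqP; rewrite -subr_eq0; apply/eqP.
by apply: (total_orth0 tv) => i; rewrite innerBr xy subrr.
Qed.

(** Taking adjoints reduces the claim to two vectors of K that have the same
    inner products with the family. *)
Lemma total_linear_ext {K L : hilbertType R} (v : I -> K)
    (A B : {linear K -> L}) : total v -> continuous A -> continuous B ->
  (forall i, A (v i) = B (v i)) -> forall x, A x = B x.
Proof.
move=> tv cA cB AB x; apply: inner_extl => y.
rewrite innerC [RHS]innerC (adjointP cA) (adjointP cB); congr (_^*); congr '[_, _].
by apply: (total_inner_ext tv) => i; rewrite -(adjointP cA) -(adjointP cB) AB.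
Qed.

Context {K K' : hilbertType R} {v : I -> K} {v' : I -> K'}.

Hypothesis gram : forall i j, '[v i, v j] = '[v' i, v' j].

(** The graph of the future unitary over the span of v. It is kept a relation:
    that it is a function depends on the equality of the Gram matrices. *)
Definition same_combination (a : K) (a' : K') : Prop :=
  exists m (c : 'I_m -> R[i]) (w : 'I_m -> I),
    a = \sum_(j < m) c j *: v (w j) /\ a' = \sum_(j < m) c j *: v' (w j).

Lemma same_combination_exists a : linear_span (range v) a ->
  exists a', same_combination a a'.
Proof.
move=> [m [c [w [wv ->]]]].
have /choice[k kw] : forall j, exists i, v i = w j.
  by move=> j; have [i _ <-] := wv j; exists i.
exists (\sum_(j < m) c j *: v' (k j)), m, c, k; split=> //.
by apply: eq_bigr => j _; rewrite kw.
Qed.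

Lemma same_combination_gen i : same_combination (v i) (v' i).
Proof. by exists 1, (fun=> 1), (fun=> i); rewrite !big_ord1 !scale1r. Qed.

Lemma same_combination_inner a a' b b' :
  same_combination a a' -> same_combination b b' -> '[a, b] = '[a', b'].
Proof.
move=> [m [c [w [-> ->]]]] [n [d [u [-> ->]]]].
rewrite !inner_suml; apply: eq_bigr => j _; rewrite !inner_sumr.
by congr (_ * _); apply: eq_bigr => k _; rewrite gram.
Qed.

Lemma same_combination_dist a a' b b' :
  same_combination a a' -> same_combination b b' -> `|a - b| = `|a' - b'|.
Proof.
move=> aa bb; apply: eq_inner_norm; rewrite !innerBl !innerBr.
by rewrite !(same_combination_inner aa aa, same_combination_inner aa bb,
  same_combination_inner bb aa, same_combination_inner bb bb).
Qed.

(** The correspondence between combinations preserves distances, so it turns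
    combinations of v that tend to x into a Cauchy filter of K', whose limit
    is x'. *)
Lemma gram_transport (x : K) : total v ->
  exists x' : K', (forall i, '[x', v' i] = '[x, v i]) /\ `|x'| = `|x|.
Proof.
move=> tv; set D := linear_span (range v).
have xD : closure D x by rewrite /D tv.
have FF := within_nbhs_proper xD.
have /choice[g gP] : forall a, exists a', D a -> same_combination a a'.
  move=> a; have [/same_combination_exists[a' aa]|nD] := pselect (D a).
    by exists a'.
  by exists 0.
set F := within D (nbhs x) in FF *.
have gF : ProperFilter (g @ F) by exact: fmap_proper_filter.
have gC : cauchy (g @ F).
  apply: cauchy_exP => e e0; have e20 : 0 < e / 2 by rewrite divr_gt0.
  have [a [Da xa]] := xD _ (nbhsx_ballx x _ e20).
  exists (g a).
  have xb : \forall b \near F, ball x (e / 2) b.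
    by apply: cvg_within; exact: nbhsx_ballx.
  have Db : \forall b \near F, D b by exact: withinT.
  apply: filterS2 xb Db => b xb Db.
  rewrite -ball_normE /ball_ /=.
  rewrite -(same_combination_dist (gP _ Da) (gP _ Db)).
  by move: (ball_splitr xa xb); rewrite -ball_normE.
have /cvg_ex[u gu] : cvg (g @ F) by exact: cauchy_cvg.
have Fx : id @ F --> x by exact: cvg_within.
have FD : \forall a \near F, D a by exact: withinT.
exists u; split=> [i|].
- have xi : (fun a => '[g a, v' i]) @ F --> '[x, v i].
    apply: (cvg_trans _ (cvg_innerl (y := v i) Fx)).
    apply: near_eq_cvg; apply: filterS FD => a Da /=.
    exact: (same_combination_inner (gP _ Da) (same_combination_gen i)).
  exact: (cvg_unique (@norm_hausdorff _ _) (cvg_innerl (y := v' i) gu) xi).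
- have xn : (fun a => `|g a|) @ F --> `|x|.
    apply: (cvg_trans _ (cvg_norm Fx)).
    apply: near_eq_cvg; apply: filterS FD => a Da /=.
    exact/eq_inner_norm/(same_combination_inner (gP _ Da) (gP _ Da)).
  exact: (cvg_unique (@norm_hausdorff _ _) (cvg_norm gu) xn).
Qed.

End TotalFamily.

(** The inner products with v' characterise the vector produced by
    [gram_transport]. This makes Z a function, makes it linear, and, with the
    roles of the two families exchanged, gives surjectivity. *)
Lemma gram_unitary {R : realType} {I : Type} {K K' : hilbertType R}
    {v : I -> K} {v' : I -> K'} : total v -> total v' ->
    (forall i j, '[v i, v j] = '[v' i, v' j]) ->
  exists Z : {linear K -> K'}, unitary Z /\ forall i, Z (v i) = v' i.
Proof.
move=> tv tv' gram.
have /choice[z zP] x := gram_transport gram x tv.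
have zE x x' : (forall i, '[x', v' i] = '[x, v i]) -> z x = x'.
  move=> xx; apply: (total_inner_ext tv') => i.
  by rewrite innerC (zP x).1 -xx -innerC.
have z_lin : linear z.
  move=> a x y; apply: zE => i.
  by rewrite !innerDl !innerZl (zP x).1 (zP y).1.
pose Z : {linear K -> K'} := HB.pack z (GRing.isLinear.Build R[i] K K' *:%R z z_lin).
have Zv i : Z (v i) = v' i by apply: zE => j; rewrite gram.
have cZ : continuous Z.
  by apply: (@bounded_continuous _ _ _ Z 1) => // x; rewrite mul1r (zP x).2.
(* It is enough that the adjoint of Z is a left inverse of Z. *)
have iZ : isometric Z.
  move=> x y; rewrite (adjointP cZ); congr '[_, _].
  apply: (total_inner_ext tv) => i; rewrite -(adjointP cZ) Zv.
  by rewrite innerC (zP y).1 -innerC.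
exists Z; split=> //; split=> // x'.
have [x [xx _]] := gram_transport (fun i j => esym (gram i j)) x' tv'.
by exists x; apply: zE => i; rewrite xx.
Qed.

(** * 2-isometries *)

Lemma adjointPl {R : realType} {H K : hilbertType R} (A : {linear H -> K}) :
  continuous A -> forall x y, '[adjoint A y, x] = '[y, A x].
Proof. by move=> cA x y; rewrite innerC -(adjointP cA) -innerC. Qed.

(** This form mentions S alone, so it can be restricted to an invariant
    subspace, where the adjoint is a different operator. *)
Lemma two_isometryP {R : realType} {K : hilbertType R} (S : {linear K -> K}) :
  two_isometry S <->
  continuous S /\
  forall x y, '[S (S x), S (S y)] = 2 * '[S x, S y] - '[x, y].
Proof.
have sq x y : continuous S ->
    '[adjoint S (adjoint S (S (S x))) - 2 *: adjoint S (S x) + x, y]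
    = '[S (S x), S (S y)] - (2 * '[S x, S y] - '[x, y]).
  move=> cS; rewrite innerDl innerBl innerZl !adjointPl//.
  by rewrite opprB addrA addrAC.
split=> -[cS S2]; split=> //.
  by move=> x y; apply/eqP; rewrite -subr_eq0 -sq// S2 inner0l.
by move=> x; apply: inner_extl => y; rewrite innerC sq// S2 subrr inner0r rmorph0.
Qed.

(** The 2-isometry identity expresses the entry (n + 2, m + 2) through the
    entries (n + 1, m + 1) and (n, m), so on each diagonal the first two
    entries determine all the others. Hermitian symmetry leaves only n >= m. *)
Lemma two_isometry_orbit_gram {R : realType} {X : Type} {K K' : hilbertType R}
    {S : {linear K -> K}} {S' : {linear K' -> K'}} {u : X -> K} {u' : X -> K'} :
    two_isometry S -> two_isometry S' ->
    (forall n h g, '[iter n S (u h), u g] = '[iter n S' (u' h), u' g]) ->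
    (forall n h g, '[iter n.+1 S (u h), S (u g)]
                 = '[iter n.+1 S' (u' h), S' (u' g)]) ->
  forall n m h g, '[iter n S (u h), iter m S (u g)]
                = '[iter n S' (u' h), iter m S' (u' g)].
Proof.
move=> /two_isometryP[_ S2] /two_isometryP[_ S'2] gram0 gram1.
have diag m : (forall k h g, '[iter (k + m) S (u h), iter m S (u g)]
                  = '[iter (k + m) S' (u' h), iter m S' (u' g)]) /\
              (forall k h g, '[iter (k + m.+1) S (u h), iter m.+1 S (u g)]
                  = '[iter (k + m.+1) S' (u' h), iter m.+1 S' (u' g)]).
  elim: m => [|m [IH0 IH1]].
    by split=> k h g; rewrite ?addn0 ?addn1; [exact: gram0 | exact: gram1].
  split=> // k h g; rewrite !addnS /= S2 S'2 IH0.
  by have := IH1 k h g; rewrite addnS /= => ->.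
move=> n m h g; have [mn|/ltnW nm] := leqP m n.
  by rewrite -(subnK mn) (diag m).1.
by rewrite innerC [RHS]innerC -(subnK nm) (diag n).1.
Qed.

(** * Liftings *)

Section Lifting.
Context {R : realType} {H K : hilbertType R} {J : {linear H -> K}}.
Hypothesis J_iso : isometric J.

Lemma inner_orthoproj x g : '[x, J g] = '[orthoproj J x, g].
Proof.
have : '[x - J (orthoproj J x), J g] = 0.
  by apply: (orthoprojP x J_iso); exists g.
by rewrite innerBl J_iso => /subr0_eq.
Qed.

Lemma orthoproj_id h : orthoproj J (J h) = h.
Proof.
by apply: inner_extl => g; rewrite innerC -inner_orthoproj J_iso -innerC.
Qed.

Lemma lifting_inner_iter {T : {linear H -> H}} {S : {linear K -> K}} n h g :
  lifting J T S -> '[iter n S (J h), J g] = '[iter n T h, g].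
Proof.
move=> JTS; rewrite inner_orthoproj; congr '[_, _].
by elim: n => [|n IH] /=; rewrite ?orthoproj_id// JTS IH.
Qed.

Lemma minimal_lifting_total (S : {linear K -> K}) : minimal_lifting J S ->
  total (fun nh : nat * H => iter nh.1 S (J nh.2)).
Proof.
rewrite /minimal_lifting /total => <-; congr (closure (linear_span _)).
apply/seteqP; split=> [_ [[n h] _ <-]|_ [n _ [_ [h _ <-] <-]]].
  by exists n => //; exists (J h) => //; exists h.
by exists (n, h).
Qed.

End Lifting.

(** The bound of S is also one for its restriction, whose continuity refers to
    the topology of the complement as a space of its own. *)
Lemma restriction_two_isometry {R : realType} {K : hilbertType R} (A : set K)
    (S : {linear K -> K}) (SA : forall x, orthocomp A x -> orthocomp A (S x)) :
  two_isometry S -> two_isometry (restriction SA).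
Proof.
move=> /two_isometryP[cS S2]; apply/two_isometryP; split; last first.
  by move=> x y; exact: (S2 (val x) (val y)).
have /linear_boundedP[M [M_real SM]] := (linear_bounded_continuous S).2 cS.
apply: (bounded_continuous (M := `|M| + 1)); first by rewrite addr_ge0.
move=> x; apply: (SM (`|M| + 1) _ (val x)).
by apply: (le_lt_trans (real_ler_norm M_real)); rewrite ltrDl.
Qed.

(** * Isomorphic liftings *)

Section Isomorphism.
Context {R : realType} {H K K' : hilbertType R}.
Context {J : {linear H -> K}} {J' : {linear H -> K'}} {T : {linear H -> H}}.
Context {S : {linear K -> K}} {S' : {linear K' -> K'}}.
Hypothesis J_iso : isometric J.
Hypothesis J'_iso : isometric J'.
Hypothesis S_cont : continuous S.
Hypothesis S'_cont : continuous S'.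

(** For x' = Z x, the inner product <x', S'^*S' (J' h)> = <S' (Z x), S' (Z (J h))>
    is <S x, S (J h)> = <x, S^*S (J h)>, so Z carries S^*S (J h) to
    S'^*S' (J' h). *)
Lemma isomorphic_same_restriction : (adjoint S \o S) @` range J `<=` range J ->
  isomorphic_liftings J S J' S' ->
  same_restriction J (adjoint S \o S) J' (adjoint S' \o S').
Proof.
move=> S_inv [Z [[iZ sZ] ZS ZJ]] h.
have [g _ gE] : range J (adjoint S (S (J h))).
  by apply: S_inv; exists (J h) => //; exists h.
exists g; split=> //=; apply: inner_extl => x'; have [x <-] := sZ x'.
by rewrite -(adjointP S'_cont) -!ZJ -!ZS !iZ (adjointP S_cont) gE.
Qed.

(** Both inputs of [two_isometry_orbit_gram] are inner products of T^n h with a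
    vector of H that is the same for S and S'. *)
Lemma same_restriction_gram :
  two_isometry S -> two_isometry S' -> lifting J T S -> lifting J' T S' ->
  same_restriction J (adjoint S \o S) J' (adjoint S' \o S') ->
  forall n m h g, '[iter n S (J h), iter m S (J g)]
                = '[iter n S' (J' h), iter m S' (J' g)].
Proof.
move=> S2 S'2 JTS JTS' same; apply: (two_isometry_orbit_gram S2 S'2) => n h g.
  by rewrite (lifting_inner_iter J_iso _ _ _ JTS) (lifting_inner_iter J'_iso _ _ _ JTS').
have [k [/= Sg S'g]] := same g.
rewrite /= (adjointP S_cont) (adjointP S'_cont) Sg S'g.
by rewrite (lifting_inner_iter J_iso _ _ _ JTS) (lifting_inner_iter J'_iso _ _ _ JTS').
Qed.

Lemma gram_isomorphic : minimal_lifting J S -> minimal_lifting J' S' ->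
    (forall n m h g, '[iter n S (J h), iter m S (J g)]
                   = '[iter n S' (J' h), iter m S' (J' g)]) ->
  isomorphic_liftings J S J' S'.
Proof.
move=> /minimal_lifting_total tv /minimal_lifting_total tv' gram.
have [Z [uZ Zv]] :=
  gram_unitary tv tv' (fun p q => gram p.1 q.1 p.2 q.2).
have cZ := isometric_continuous uZ.1.
exists Z; split=> [//| |h]; last exact: (Zv (0%N, h)).
apply: (total_linear_ext (A := Z \o S) (B := S' \o Z) tv).
- by move=> x; apply: continuous_comp; [exact: S_cont | exact: cZ].
- by move=> x; apply: continuous_comp; [exact: cZ | exact: S'_cont].
- by move=> [n h] /=; rewrite (Zv (n, h)) (Zv (n.+1, h)).
Qed.

(** The isomorphism restricts: Z maps J(H) onto J'(H), hence also their
    orthogonal complements onto each other. *)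
Lemma isomorphic_restriction
    (SA : forall x, orthocomp (range J) x -> orthocomp (range J) (S x))
    (S'A : forall x, orthocomp (range J') x -> orthocomp (range J') (S' x)) :
  isomorphic_liftings J S J' S' ->
  unitarily_equivalent (restriction SA) (restriction S'A).
Proof.
move=> [Z [[iZ sZ] ZS ZJ]].
have ZP x : orthocomp (range J') (Z x) <-> orthocomp (range J) x.
  split=> xJ _ [h _ <-]; first by rewrite -iZ ZJ; apply: xJ; exists h.
  by rewrite -ZJ iZ; apply: xJ; exists h.
have Zsub (x : orthocomp_type (range J)) : Z (val x) \in orthocomp (range J').
  by have := valP x; rewrite !inE => xJ; apply/ZP.
pose z x := OrthocompSub (Zsub x).
have z_lin : linear z by move=> a x y; apply: val_inj; rewrite /= linearP.
pose Z0 : {linear orthocomp_type (range J) -> orthocomp_type (range J')} :=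
  HB.pack z (GRing.isLinear.Build R[i] _ _ *:%R z z_lin).
exists Z0; split; first split.
- by move=> x y; exact: iZ.
- move=> y; have [x xy] := sZ (val y).
  have xJ : x \in orthocomp (range J).
    by have := valP y; rewrite !inE -xy => /ZP.
  by exists (OrthocompSub xJ); apply: val_inj.
- by move=> x; apply: val_inj; exact: ZS.
Qed.

End Isomorphism.

Theorem proposition4p8 (R : realType) (H K K' : hilbertType R)
    (J : {linear H -> K}) (J' : {linear H -> K'})
    (T : {linear H -> H}) (S : {linear K -> K}) (S' : {linear K' -> K'})
    (J_iso : isometric J) (J'_iso : isometric J')
    (T_cont : continuous T)
    (S_2iso : two_isometry S) (S'_2iso : two_isometry S')
    (S_lift : lifting J T S) (S'_lift : lifting J' T S')
    (S_min : minimal_lifting J S) (S'_min : minimal_lifting J' S')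
    (S_inv : (adjoint S \o S) @` range J `<=` range J)
    (S'_inv : (adjoint S' \o S') @` range J' `<=` range J') :
  (isomorphic_liftings J S J' S' <->
     same_restriction J (adjoint S \o S) J' (adjoint S' \o S')) /\
  [/\ two_isometry (restriction (lifting_orthocomp J_iso S_lift)),
      two_isometry (restriction (lifting_orthocomp J'_iso S'_lift)) &
      isomorphic_liftings J S J' S' ->
        unitarily_equivalent (restriction (lifting_orthocomp J_iso S_lift))
                             (restriction (lifting_orthocomp J'_iso S'_lift))].
Proof.
have [[S_cont _] [S'_cont _]] := (S_2iso, S'_2iso); split; first split.
- exact: isomorphic_same_restriction.
- move=> same; apply: gram_isomorphic => //.
  exact: (same_restriction_gram J_iso J'_iso).
- by split; [exact: restriction_two_isometry | exact: restriction_two_isometry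
            | exact: isomorphic_restriction].
Qed.
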